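(* Let $\tau=\tau(t)$ be a KdV tau function. That is, $\tau$ is not identically zero and satisfies (1) the Fay identity: for all $z_0,z_1,z_2,z_3\in\mathbb C$, $$(z_0-z_1)(z_2-z_3)\,\tau(t+[z_0]+[z_1])\,\tau(t+[z_2]+[z_3])+(z_0-z_2)(z_3-z_1)\,\tau(t+[z_0]+[z_2])\,\tau(t+[z_3]+[z_1])+(z_0-z_3)(z_1-z_2)\,\tau(t+[z_0]+[z_3])\,\tau(t+[z_1]+[z_2])=0,$$ (2) the KdV condition: $\partial_{t_{2k}}\tau=0$ for $k=1,2,3,\dots$ (so that $\tau(t-[z])=\tau(t+[-z])$ for every $z\in\mathbb C$). Then the Fay identity (1), together with (2), implies the Faddeev–Tahtajan identity for the wave functions $\psi,\psi^*$ of $\tau$: for all nonzero $z_1,z_2\in\mathbb C$ with $z_1^2\neq z_2^2$, $$W\bigl(\psi(t,z_1)\psi^*(t,z_1),\,\psi(t,z_2)\psi^*(t,z_2)\bigr)=-(z_1^2-z_2^2)^{-1}\,\partial_x\Bigl[W\bigl(\psi(t,z_1),\psi(t,z_2)\bigr)\,W\bigl(\psi^*(t,z_1),\psi^*(t,z_2)\bigr)\Bigr]$$ $$=-(z_1^2-z_2^2)^{-1}\,\partial_x\Bigl[W\bigl(\psi(t,z_1),\psi^*(t,z_2)\bigr)\,W\bigl(\psi^*(t,z_1),\psi(t,z_2)\bigr)\Bigr].$$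
   Context: Notation: $t=(t_1,t_2,t_3,\dots)\in\mathbb C^\infty$, $x\equiv t_1$, $\partial_x=\partial/\partial x$, $'=\partial_x$. For $z\in\mathbb C$, $[z]:=(z,z^2/2,z^3/3,\dots)\in\mathbb C^\infty$, so $\tau(t\pm[z])=\tau(t_1\pm z,t_2\pm z^2/2,t_3\pm z^3/3,\dots)$. The Wronskian is $W(f,g):=fg'-f'g$. The wave functions associated with $\tau$ are $$\psi(t,z):=\exp\Bigl(\sum_{k\ge1}t_kz^k\Bigr)\frac{\tau(t-[z^{-1}])}{\tau(t)},\qquad \psi^*(t,z):=\exp\Bigl(-\sum_{k\ge1}t_kz^k\Bigr)\frac{\tau(t+[z^{-1}])}{\tau(t)}.$$ For a KdV tau function these are solutions of the Sturm–Liouville equation $(\partial_x^2+u)\psi=z^2\psi$ with $u=2\,\partial_x^2\ln\tau$, where $t_3,t_5,\dots$ are parameters. Background: every tau function of the Kadomtsev–Petviashvili (KP) hierarchy satisfies the Fay identity, and KdV tau functions are the KP tau functions independent of the even times $t_2,t_4,\dots$. Conventions: $\tau$ is regular enough (e.g. polynomial, analytic, or a formal power series with the $z_i$ treated accordingly) that the partial derivatives exist and shifts are differentiated by the chain rule $\partial_z\,\tau(t+[z])=\sum_{k\ge1}z^{k-1}(\partial_{t_k}\tau)(t+[z])$. Identities involving division by $\tau(t)$ are understood where $\tau(t)\ne0$, and all identities are understood where the expressions are defined. *)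

(* Defs.v *)
From Stdlib Require Import Reals Arith.
From Coquelicot Require Export Coquelicot.

Set Implicit Arguments.
Local Open Scope C_scope.

(* A point t = (t_1, t_2, t_3, ...) of C^infty is a sequence indexed from 0:
   [t n] is t_{n+1}.  Thus x = t_1 is [t 0], and the even times are the
   [t (2 * k + 1)]. *)
Definition times : Set := nat -> C.

Definition tadd (s t : times) : times := fun n => s n + t n.
Definition topp (t : times) : times := fun n => - t n.

Definition bracket (z : C) : times := fun n => z ^ (n + 1) / INR (n + 1).

Declare Scope times_scope.
Delimit Scope times_scope with times.
Bind Scope times_scope with times.
Notation "s [+] t" := (tadd s t)
  (at level 50, left associativity) : times_scope.
Notation "s [-] t" := (tadd s (topp t))
  (at level 50, left associativity) : times_scope.
Notation "[[ z ]]" := (bracket z%C) (at level 0) : times_scope.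

Definition set_time (t : times) (n : nat) (c : C) : times :=
  fun m => if Nat.eqb m n then c else t m.

(* [pd n F] is the partial derivative of F with respect to t_{n+1}. *)
Definition pd (n : nat) (F : times -> C) : times -> C :=
  fun t => C_derive (fun c => F (set_time t n c)) (t n).

Definition pdx : (times -> C) -> times -> C := pd 0.

Definition wronskian (F G : times -> C) : times -> C :=
  fun t => F t * pdx G t - pdx F t * G t.

(* Meaningful when [ex_series a]; Coquelicot's [Series] is real valued. *)
Definition CSeries (a : nat -> C) : C :=
  (Series (fun n => Re (a n)), Series (fun n => Im (a n))).

Definition Cexp (z : C) : C :=
  ((exp (Re z) * cos (Im z))%R, (exp (Re z) * sin (Im z))%R).

Definition xi_term (t : times) (z : C) (n : nat) : C := t n * z ^ (n + 1).
Definition xi (t : times) (z : C) : C := CSeries (xi_term t z).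

Definition psi (tau : times -> C) (z : C) : times -> C :=
  fun t => Cexp (xi t z) * (tau (t [-] [[/ z]])%times / tau t).

Definition psi_star (tau : times -> C) (z : C) : times -> C :=
  fun t => Cexp (- xi t z) * (tau (t [+] [[/ z]])%times / tau t).

(* Where tau and its shifts make sense: tau is defined on D, and may be shifted
   by [z] for |z| < rho.  Polynomials, and entire functions of finitely many
   t_k, have D = C^infty and rho = p_infty.  A sum of exponentials exp (sum_k kappa^k t_k), such as a
   soliton tau function, lives on {t | sum_k |t_k| r^k < infinity} with
   r >= max |kappa| and rho = 1 / r. *)
Record tau_domain (D : times -> Prop) (rho : Rbar) : Prop := {
  domain_shift : forall t z, D t -> Rbar_lt (Cmod z) rho ->
    D (t [+] [[z]])%times /\ D (t [-] [[z]])%times;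
  domain_open : forall t n, D t ->
    exists eps : R, (0 < eps)%R /\
      forall c : C, (Cmod (c - t n) < eps)%R -> D (set_time t n c)
}.

(* The chain rule for the shifts [f w] + [g w], with f and g holomorphic.  The
   case f = id, g = 0 is
     d/dz tau (t + [z]) = sum_(k >= 1) z^(k-1) (d tau / d t_k) (t + [z]). *)
Record regular (D : times -> Prop) (rho : Rbar) (tau : times -> C) : Prop := {
  regular_partial : forall t n, D t ->
    ex_derive (K := C_AbsRing) (V := C_NormedModule)
      (fun c : C => tau (set_time t n c)) (t n);
  regular_chain : forall (t : times) (f g : C -> C) (z df dg : C),
    D t -> Rbar_lt (Cmod (f z)) rho -> Rbar_lt (Cmod (g z)) rho ->
    is_derive (K := C_AbsRing) (V := C_NormedModule) f z df ->
    is_derive (K := C_AbsRing) (V := C_NormedModule) g z dg ->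
    let a n := (df * f z ^ n + dg * g z ^ n)
               * pd n tau (t [+] [[f z]] [+] [[g z]])%times in
    ex_series (K := C_AbsRing) (V := C_NormedModule) a /\
    is_derive (K := C_AbsRing) (V := C_NormedModule)
      (fun w : C => tau (t [+] [[f w]] [+] [[g w]])%times) z (CSeries a)
}.

Definition not_identically_zero (D : times -> Prop) (tau : times -> C) : Prop :=
  exists t, D t /\ tau t <> 0.

Definition Fay_identity (D : times -> Prop) (rho : Rbar) (tau : times -> C)
  : Prop :=
  forall (t : times) (z0 z1 z2 z3 : C), D t ->
    Rbar_lt (Cmod z0) rho -> Rbar_lt (Cmod z1) rho ->
    Rbar_lt (Cmod z2) rho -> Rbar_lt (Cmod z3) rho ->
    (z0 - z1) * (z2 - z3)
      * tau (t [+] [[z0]] [+] [[z1]])%times * tau (t [+] [[z2]] [+] [[z3]])%times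
    + (z0 - z2) * (z3 - z1)
      * tau (t [+] [[z0]] [+] [[z2]])%times * tau (t [+] [[z3]] [+] [[z1]])%times
    + (z0 - z3) * (z1 - z2)
      * tau (t [+] [[z0]] [+] [[z3]])%times * tau (t [+] [[z1]] [+] [[z2]])%times
    = 0.

Definition KdV_condition (D : times -> Prop) (tau : times -> C) : Prop :=
  forall (t : times) (k : nat), D t -> pd (2 * k + 1) tau t = 0.

(* Main.v *)
(* Idea. By the chain rule and the KdV condition, tau (t + [w] + [-w]) has zero
   w-derivative, so tau (t - [z]) = tau (t + [-z]).  The coefficient of z0 in the Fay
   identity at z3 = 0 is the differential Fay identity, which evaluates every
   Wronskian of wave functions without x-derivatives:
     W (psi z1, psi z2) = e^(xi z1 + xi z2) (z2 - z1) tau (t - [1/z1] - [1/z2]) / tau t,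
   with z replaced by -z for psi_star.  Hence only first x-derivatives of tau survive
   in the claim; they are eliminated by the differential Fay identity based at t and
   at t -+ [1/z1].  By the Fay identity for z1, z2, -z1, -z2 the two products of
   Wronskians differ by the constant 4 z1 z2, whence the second equality. *)
Require Import Defs.
From Stdlib Require Import Reals Lra FunctionalExtensionality.
From Coquelicot Require Import Coquelicot.
Local Open Scope C_scope.

(** * Complex derivatives: epsilon form, products and the inverse *)

Notation is_Cderive f z l :=
  (is_derive (K := C_AbsRing) (V := C_NormedModule) f (z : C) (l : C)).

(** Unfolds [filterdiff]: multiplication by [l] is always linear, and the only limit point of
    [locally z] is [z] itself. *)
Lemma is_Cderive_eps (f : C -> C) (z l : C) :
  is_Cderive f z l <->
  forall eps : R, (0 < eps)%R -> exists delta : R, (0 < delta)%R /\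
    forall w : C, (Cmod (w - z) < delta)%R ->
      (Cmod (f w - f z - (w - z) * l) <= eps * Cmod (w - z))%R.
Proof.
split.
- intros [_ H] eps Heps.
  destruct (H z (fun P HP => HP) (mkposreal eps Heps)) as [d Hd].
  exists d; split; [apply cond_pos |].
  exact Hd.
- intros H; split; [apply is_linear_scal_l |].
  intros y Hy eps.
  rewrite <- (is_filter_lim_locally_unique _ _ Hy).
  destruct (H eps (cond_pos eps)) as (d & Hd & Hw).
  exists (mkposreal d Hd).
  exact Hw.
Qed.

Lemma is_Cderive_eq (f : C -> C) (z l l' : C) :
  is_Cderive f z l -> l = l' -> is_Cderive f z l'.
Proof. now intros H <-. Qed.

Lemma is_Cderive_const (c z : C) : is_Cderive (fun _ => c) z 0.
Proof. exact (is_derive_const (K := C_AbsRing) (V := C_NormedModule) c z). Qed.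

(* The general product and composition rules are stated for the right-hand structure on
   C, which has the same norm but is not convertible to [C_NormedModule]. *)
Lemma is_Cderive_AbsRing (f : C -> C) (z l : C) :
  is_Cderive f z l <->
  is_derive (K := C_AbsRing) (V := AbsRing_NormedModule C_AbsRing) f z l.
Proof. split; intros [_ H]; (split; [apply is_linear_scal_l | exact H]). Qed.

Lemma is_Cderive_mult (f g : C -> C) (z df dg : C) :
  is_Cderive f z df -> is_Cderive g z dg ->
  is_Cderive (fun w => f w * g w) z (df * g z + f z * dg).
Proof.
rewrite !is_Cderive_AbsRing; intros Hf Hg.
exact (is_derive_mult (K := C_AbsRing) f g z df dg Hf Hg Cmult_comm).
Qed.

Lemma is_Cderive_inv (z : C) : z <> 0 -> is_Cderive Cinv z (- / (z * z)).
Proof.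
intros Hz; apply is_Cderive_eps; intros eps Heps.
assert (Hm : (0 < Cmod z)%R) by now apply Cmod_gt_0.
set (m := Cmod z) in *.
(* The error is (w - z)^2 / (w z^2). The first bound forces |w| > m / 2, and then the second gives
   |w - z| <= eps |w| m^2. *)
exists (Rmin (m / 2) (eps * (m * m * m) / 2)); split.
{ apply Rmin_pos; [lra |].
  apply Rdiv_lt_0_compat; [| lra].
  now repeat apply Rmult_lt_0_compat. }
intros w Hw.
assert (H1 := Rlt_le_trans _ _ _ Hw (Rmin_l _ _)).
assert (H2 := Rlt_le_trans _ _ _ Hw (Rmin_r _ _)).
assert (Hwm : (m / 2 < Cmod w)%R).
{ assert (T := Cmod_triangle w (- (w - z))).
  replace (w + - (w - z)) with z in T by ring.
  rewrite Cmod_opp in T; fold m in T; lra. }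
assert (Hw0 : w <> 0) by (apply Cmod_gt_0; lra).
replace (/ w - / z - (w - z) * - / (z * z))
  with ((w - z) * ((w - z) * / (w * (z * z)))) by (field; auto).
rewrite !Cmod_mult, Cmod_inv, !Cmod_mult; fold m; [| now repeat apply Cmult_neq_0].
rewrite (Rmult_comm eps).
apply Rmult_le_compat_l; [apply Cmod_ge_0 |].
apply Rmult_le_reg_r with (Cmod w * (m * m))%R.
{ repeat apply Rmult_lt_0_compat; lra. }
rewrite Rmult_assoc, Rinv_l, Rmult_1_r.
2:{ apply Rgt_not_eq; repeat apply Rmult_lt_0_compat; lra. }
assert (0 < m * m)%R by now apply Rmult_lt_0_compat.
apply Rle_trans with (eps * (m / 2 * (m * m)))%R; [lra |].
apply Rmult_le_compat_l; [lra |].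
apply Rmult_le_compat_r; lra.
Qed.

(** * The complex exponential *)

Lemma Cmod_le_abs_add (z : C) : (Cmod z <= Rabs (Re z) + Rabs (Im z))%R.
Proof.
assert (T := Cmod_triangle (RtoC (Re z)) (Ci * RtoC (Im z))).
rewrite Cmod_mult, !Cmod_R in T.
replace (Cmod Ci) with 1%R in T.
2:{ unfold Cmod, Ci; simpl; symmetry.
    replace (0 * (0 * 1) + 1 * (1 * 1))%R with 1%R by ring; apply sqrt_1. }
replace (RtoC (Re z) + Ci * RtoC (Im z)) with z in T; [lra |].
destruct z; unfold Ci, RtoC, Cplus, Cmult; simpl; f_equal; ring.
Qed.

(** Multiplying the difference quotient by [h] gives a linear error bound that also covers [h = 0],
    as in [is_Cderive_eps]. *)
Lemma derivable_pt_lim_0_eps (f : R -> R) (l : R) :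
  derivable_pt_lim f 0 l -> forall eps : R, (0 < eps)%R ->
  exists delta : R, (0 < delta)%R /\ forall h : R, (Rabs h < delta)%R ->
    (Rabs (f h - f 0 - h * l) <= eps * Rabs h)%R.
Proof.
intros H eps Heps; destruct (H eps Heps) as [d Hd].
exists d; split; [apply cond_pos |]; intros h Hh.
destruct (Req_dec h 0) as [-> | Hn].
- replace (f 0 - f 0 - 0 * l)%R with 0%R by ring; rewrite Rabs_R0; lra.
- specialize (Hd h Hn Hh); rewrite Rplus_0_l in Hd.
  replace (f h - f 0 - h * l)%R with (((f h - f 0) / h - l) * h)%R by now field.
  rewrite Rabs_mult; apply Rmult_le_compat_r; [apply Rabs_pos | lra].
Qed.

Lemma Cexp_0 : Cexp 0 = 1.
Proof. unfold Cexp; simpl; rewrite exp_0, cos_0, sin_0; unfold RtoC; f_equal; ring. Qed.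

Lemma Cexp_add (z w : C) : Cexp (z + w) = Cexp z * Cexp w.
Proof.
unfold Cexp; destruct z, w; unfold Cmult; simpl.
rewrite exp_plus, cos_plus, sin_plus; f_equal; ring.
Qed.

Lemma Cexp_mul_opp (z : C) : Cexp z * Cexp (- z) = 1.
Proof. rewrite <- Cexp_add, <- Cexp_0; f_equal; ring. Qed.

(** Write exp x = 1 + x + E, cos y = 1 + K, sin y = y + S, each remainder being at most e |h|. The
    product expands to 1 + h plus terms small against |h|. *)
Lemma is_Cderive_Cexp_0 : is_Cderive Cexp 0 1.
Proof.
apply is_Cderive_eps; intros eps Heps.
(* With r = |h| the errors below add up to at most 9 e r, so [eps / 12] suffices. The cap 1 and r <
   e give |1 + x + E| <= 3 and |y + S| <= 2 e. *)
set (e := Rmin (eps / 12) 1).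
assert (He0 : (0 < e)%R) by (apply Rmin_pos; lra).
assert (He1 : (e <= 1)%R) by apply Rmin_r.
assert (He2 : (12 * e <= eps)%R) by (generalize (Rmin_l (eps / 12) 1); fold e; lra).
destruct (derivable_pt_lim_0_eps _ _ derivable_pt_lim_exp_0 e He0) as (d1 & Hd1 & H1).
assert (Hcos := derivable_pt_lim_cos 0); rewrite sin_0 in Hcos.
destruct (derivable_pt_lim_0_eps _ _ Hcos e He0) as (d2 & Hd2 & H2).
assert (Hsin := derivable_pt_lim_sin 0); rewrite cos_0 in Hsin.
destruct (derivable_pt_lim_0_eps _ _ Hsin e He0) as (d3 & Hd3 & H3).
exists (Rmin (Rmin d1 d2) (Rmin d3 e)); split; [repeat apply Rmin_pos; lra |].
intros h; rewrite Cexp_0.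
replace (h - 0) with h by ring; replace (h * 1) with h by ring.
intros Hh.
assert (Hhd : (Cmod h < d1 /\ Cmod h < d2 /\ Cmod h < d3 /\ Cmod h < e)%R).
{ generalize (Rmin_l (Rmin d1 d2) (Rmin d3 e)) (Rmin_r (Rmin d1 d2) (Rmin d3 e))
    (Rmin_l d1 d2) (Rmin_r d1 d2) (Rmin_l d3 e) (Rmin_r d3 e); lra. }
destruct h as [x y].
assert (Hx := Rle_trans _ _ _ (Rmax_l _ _) (Rmax_Cmod (x, y))).
assert (Hy := Rle_trans _ _ _ (Rmax_r _ _) (Rmax_Cmod (x, y))).
simpl in Hx, Hy.
set (r := Cmod (x, y)) in *.
specialize (H1 x ltac:(lra)); specialize (H2 y ltac:(lra)); specialize (H3 y ltac:(lra)).
rewrite exp_0 in H1; rewrite cos_0 in H2; rewrite sin_0 in H3.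
replace (exp x - 1 - x * 1)%R with (exp x - 1 - x)%R in H1 by ring.
replace (cos y - 1 - y * - 0)%R with (cos y - 1)%R in H2 by ring.
replace (sin y - 0 - y * 1)%R with (sin y - y)%R in H3 by ring.
set (E := (exp x - 1 - x)%R) in *; set (K := (cos y - 1)%R) in *; set (S := (sin y - y)%R) in *.
assert (Px := Rabs_pos x); assert (Py := Rabs_pos y).
assert (Hr : (0 <= r)%R) by apply Cmod_ge_0.
assert (Her : (e * Rabs x <= e * r /\ e * Rabs y <= e * r)%R).
{ split; apply Rmult_le_compat_l; lra. }
assert (Herr : (e * r <= 1 * r)%R) by (apply Rmult_le_compat_r; lra).
eapply Rle_trans; [apply Cmod_le_abs_add |].
replace (Re (Cexp (x, y) - 1 - (x, y))) with (E + (1 + x + E) * K)%R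
  by (unfold Cexp, E, K; simpl; ring).
replace (Im (Cexp (x, y) - 1 - (x, y))) with ((x + E) * (y + S) + S)%R
  by (unfold Cexp, E, K, S; simpl; ring).
assert (HK : (Rabs ((1 + x + E) * K) <= 3 * (e * r))%R).
{ rewrite Rabs_mult.
  apply Rmult_le_compat; try apply Rabs_pos; [| lra].
  eapply Rle_trans; [apply Rabs_triang |].
  assert (T := Rabs_triang 1 x); rewrite Rabs_R1 in T; lra. }
assert (HS : (Rabs ((x + E) * (y + S)) <= (2 * r) * (2 * e))%R).
{ rewrite Rabs_mult.
  apply Rmult_le_compat; try apply Rabs_pos.
  - assert (T := Rabs_triang x E); lra.
  - assert (T := Rabs_triang y S); lra. }
assert (T1 := Rabs_triang E ((1 + x + E) * K)).
assert (T2 := Rabs_triang ((x + E) * (y + S)) S).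
assert (12 * e * r <= eps * r)%R by (apply Rmult_le_compat_r; lra).
assert (0 <= e * r)%R by (apply Rmult_le_pos; lra).
lra.
Qed.

(** The addition law transports the derivative at 0 to [z]. *)
Lemma is_Cderive_Cexp (z : C) : is_Cderive Cexp z (Cexp z).
Proof.
apply is_derive_ext with (fun w => Cexp z * Cexp (w - z)).
{ intros w; rewrite <- Cexp_add; f_equal; ring. }
assert (H : is_Cderive (fun w => Cexp (w - z)) z 1).
{ apply is_Cderive_eps; intros eps Heps.
  destruct (proj1 (is_Cderive_eps _ _ _) is_Cderive_Cexp_0 eps Heps) as (d & Hd & H).
  exists d; split; [exact Hd |]; intros w Hw.
  specialize (H (w - z)); replace (w - z - 0) with (w - z) in H by ring.
  replace (z - z) with (RtoC 0) by ring; auto. }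
refine (is_Cderive_eq _ _ _ _
  (is_Cderive_mult _ _ _ _ _ (is_Cderive_const (Cexp z) z) H) _).
ring.
Qed.

(** * Vanishing derivatives on a disk, and further derivative rules *)

Lemma C_R_norm_Cmod (z : C) : norm (V := C_R_NormedModule) z = Cmod z.
Proof.
change (sqrt (Rabs (fst z) ^ 2 + Rabs (snd z) ^ 2) = Cmod z).
now rewrite !pow2_abs.
Qed.

(** On the segment s z with 0 <= s <= 1, which stays in the disk, [f] is a function of a real
    variable with zero derivative. [C_R_NormedModule] views C as a real space for this purpose. *)
Lemma Cderive_0_constant_disk (f : C -> C) (rho : Rbar) :
  (forall w, Rbar_lt (Cmod w) rho -> is_Cderive f w 0) ->
  forall z, Rbar_lt (Cmod z) rho -> f z = f 0.
Proof.
intros H z Hz.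
replace (f 0) with (f (RtoC 0 * z)) by (f_equal; ring).
replace (f z) with (f (RtoC 1 * z)) by (f_equal; ring).
symmetry.
apply (eq_is_derive (V := C_R_NormedModule) (fun s : R => f (RtoC s * z))); [| lra].
intros s Hs.
assert (Hd : is_Cderive f (RtoC s * z) 0).
{ apply H; apply Rbar_le_lt_trans with (Cmod z); [| exact Hz].
  simpl; rewrite Cmod_mult, Cmod_R, Rabs_right by lra.
  generalize (Cmod_ge_0 z); nra. }
split; [apply is_linear_scal_l |].
intros y Hy eps; rewrite <- (is_filter_lim_locally_unique _ _ Hy).
(* A bound for |z| that is positive even when [z = 0], so that it can be divided by. *)
set (m := (Cmod z + 1)%R).
assert (Hm : (0 < m)%R) by (generalize (Cmod_ge_0 z); unfold m; lra).
assert (Hq : (0 < eps / m)%R) by (apply Rdiv_lt_0_compat; [apply cond_pos | exact Hm]).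
destruct (proj1 (is_Cderive_eps _ _ _) Hd _ Hq) as (d & Hd0 & Hw).
assert (Hq' : (0 < d / m)%R) by (apply Rdiv_lt_0_compat; assumption).
exists (mkposreal _ Hq'); intros v Hv.
change (Rabs (v - s) < d / m)%R in Hv.
assert (Hvs : (Cmod (RtoC v * z - RtoC s * z) <= Rabs (v - s) * m)%R).
{ replace (RtoC v * z - RtoC s * z) with (RtoC (v - s) * z)
    by (rewrite RtoC_minus; ring).
  rewrite Cmod_mult, Cmod_R; apply Rmult_le_compat_l; [apply Rabs_pos | unfold m; lra]. }
assert (Hlt : (Rabs (v - s) * m < d)%R).
{ apply Rmult_lt_compat_r with (r := m) in Hv; [| exact Hm].
  replace (d / m * m)%R with d in Hv by (field; lra); exact Hv. }
specialize (Hw (RtoC v * z) (Rle_lt_trans _ _ _ Hvs Hlt)).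
replace (f (RtoC v * z) - f (RtoC s * z) - (RtoC v * z - RtoC s * z) * 0)
  with (f (RtoC v * z) - f (RtoC s * z)) in Hw by ring.
rewrite (scal_zero_r (V := C_R_ModuleSpace)), C_R_norm_Cmod.
change (Rle (Cmod (f (RtoC v * z) - f (RtoC s * z) - 0)) (eps * Rabs (v - s))).
replace (f (RtoC v * z) - f (RtoC s * z) - 0)
  with (f (RtoC v * z) - f (RtoC s * z)) by ring.
apply Rle_trans with (1 := Hw).
apply Rle_trans with (eps / m * (Rabs (v - s) * m))%R.
- apply Rmult_le_compat_l; lra.
- right; field; lra.
Qed.

Lemma is_Cderive_id (z : C) : is_Cderive (fun w => w) z 1.
Proof. apply is_Cderive_AbsRing; exact (is_derive_id (K := C_AbsRing) z). Qed.

Lemma is_Cderive_plus (f g : C -> C) (z df dg : C) :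
  is_Cderive f z df -> is_Cderive g z dg ->
  is_Cderive (fun w => f w + g w) z (df + dg).
Proof. exact (is_derive_plus (K := C_AbsRing) (V := C_NormedModule) f g z df dg). Qed.

Lemma is_Cderive_comp (f g : C -> C) (z df dg : C) :
  is_Cderive f (g z) df -> is_Cderive g z dg ->
  is_Cderive (fun w => f (g w)) z (dg * df).
Proof.
rewrite (is_Cderive_AbsRing g).
exact (is_derive_comp (K := C_AbsRing) (V := C_NormedModule) f g z df dg).
Qed.

Lemma is_Cderive_affine (p q k z : C) : is_Cderive (fun w => p + (w - q) * k) z k.
Proof.
apply is_Cderive_eps; intros eps Heps; exists 1%R; split; [lra |]; intros w _.
replace (p + (w - q) * k - (p + (z - q) * k) - (w - z) * k) with (RtoC 0) by ring.
rewrite Cmod_0; apply Rmult_le_pos; [lra | apply Cmod_ge_0].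
Qed.

Lemma is_Cderive_unique (f : C -> C) (z l l' : C) :
  is_Cderive f z l -> is_Cderive f z l' -> l = l'.
Proof.
intros H H'.
now rewrite <- (is_C_derive_unique f z l H), <- (is_C_derive_unique f z l' H').
Qed.

(** * Complex series *)

Lemma ex_series_Re_Im (a : nat -> C) :
  ex_series (K := C_AbsRing) (V := C_NormedModule) a ->
  ex_series (fun n => Re (a n)) /\ ex_series (fun n => Im (a n)).
Proof.
intros [l Hl].
assert (Hsum : forall n, sum_n a n = (sum_n (fun n => Re (a n)) n, sum_n (fun n => Im (a n)) n)).
{ induction n as [| n IH].
  - rewrite !sum_O; destruct (a 0%nat); reflexivity.
  - rewrite !sum_Sn, IH; destruct (a (S n)); reflexivity. }
assert (Hb := proj1 (filterlim_locally _ _) Hl).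
split; [exists (fst l) | exists (snd l)]; apply filterlim_locally; intros eps;
  destruct (Hb eps) as [N HN]; exists N; intros n Hn;
  specialize (HN n Hn); rewrite Hsum in HN; apply HN.
Qed.

Lemma Series_head (a : nat -> R) : (forall n, a (S n) = 0%R) -> Series a = a 0%nat.
Proof.
intros H; apply is_series_unique.
apply filterlim_ext with (fun _ => a 0%nat); [| apply filterlim_const].
induction x as [| n IH]; [now rewrite sum_O |].
rewrite sum_Sn, <- IH, H; symmetry; apply Rplus_0_r.
Qed.

(** Evaluates the chain-rule series of [regular_chain] in the two cases that occur: a shift at w =
    0, where only w^0 survives, and the shifts by w and -w, where every term vanishes. *)
Lemma CSeries_head (a : nat -> C) : (forall n, a (S n) = 0) -> CSeries a = a 0%nat.
Proof.
intros H; unfold CSeries.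
rewrite (Series_head (fun n => Re (a n))), (Series_head (fun n => Im (a n)));
  try (intros n; now rewrite H).
destruct (a 0%nat); reflexivity.
Qed.

(** * Derivatives in x of functions of the times *)

Definition is_pdx (F : times -> C) (t : times) (l : C) : Prop :=
  is_Cderive (fun c => F (set_time t 0 c)) (t 0%nat) l.

(** A neighbourhood inside the x-line only: this is all that an x-derivative sees, and [domain_open]
    moves one time at once. *)
Definition near_x (t : times) (P : times -> Prop) : Prop :=
  exists delta : R, (0 < delta)%R /\
    forall c, (Cmod (c - t 0%nat) < delta)%R -> P (set_time t 0 c).

Lemma set_time_id (t : times) (n : nat) : set_time t n (t n) = t.
Proof.
apply functional_extensionality; intros m; unfold set_time.
now destruct (Nat.eqb_spec m n) as [-> |].
Qed.

Lemma set_time_tadd (t s : times) (n : nat) (c : C) :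
  (set_time t n c [+] s)%times = set_time (t [+] s)%times n (c + s n).
Proof.
apply functional_extensionality; intros m; unfold set_time, tadd.
now destruct (Nat.eqb_spec m n) as [-> |].
Qed.

Lemma near_x_and (t : times) (P Q : times -> Prop) :
  near_x t P -> near_x t Q -> near_x t (fun u => P u /\ Q u).
Proof.
intros (d & Hd & H) (e & He & H').
exists (Rmin d e); split; [now apply Rmin_pos |]; intros c Hc; split.
- apply H, Rlt_le_trans with (1 := Hc), Rmin_l.
- apply H', Rlt_le_trans with (1 := Hc), Rmin_r.
Qed.

Lemma near_x_impl (t : times) (P Q : times -> Prop) :
  (forall u, P u -> Q u) -> near_x t P -> near_x t Q.
Proof. intros HPQ (d & Hd & H); exists d; split; [exact Hd |]; auto. Qed.

Lemma is_pdx_eq (F : times -> C) (t : times) (l l' : C) :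
  is_pdx F t l -> l = l' -> is_pdx F t l'.
Proof. now intros H <-. Qed.

(** Passes from the relation, which carries differentiability, to the total function [pdx]. *)
Lemma is_pdx_unique (F : times -> C) (t : times) (l : C) : is_pdx F t l -> pdx F t = l.
Proof. apply is_C_derive_unique. Qed.

Lemma is_pdx_ext_near (F G : times -> C) (t : times) (l : C) :
  near_x t (fun u => F u = G u) -> is_pdx F t l -> is_pdx G t l.
Proof.
intros (d & Hd & H); apply is_derive_ext_loc.
exists (mkposreal d Hd); exact H.
Qed.

Lemma is_pdx_const (c : C) (t : times) : is_pdx (fun _ => c) t 0.
Proof. apply is_Cderive_const. Qed.

Lemma is_pdx_plus (F G : times -> C) (t : times) (dF dG : C) :
  is_pdx F t dF -> is_pdx G t dG -> is_pdx (fun u => F u + G u) t (dF + dG).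
Proof. apply is_Cderive_plus. Qed.

Lemma is_pdx_mult (F G : times -> C) (t : times) (dF dG : C) :
  is_pdx F t dF -> is_pdx G t dG ->
  is_pdx (fun u => F u * G u) t (dF * G t + F t * dG).
Proof.
intros HF HG; assert (H := is_Cderive_mult _ _ _ _ _ HF HG).
cbv beta in H; now rewrite set_time_id in H.
Qed.

Lemma is_pdx_inv (F : times -> C) (t : times) (dF : C) :
  F t <> 0 -> is_pdx F t dF -> is_pdx (fun u => / F u) t (- dF / (F t * F t)).
Proof.
intros H0 HF; rewrite <- (set_time_id t 0) in H0.
assert (H := is_Cderive_comp _ _ _ _ _ (is_Cderive_inv _ H0) HF).
cbv beta in H; rewrite set_time_id in H, H0.
refine (is_Cderive_eq _ _ _ _ H _); field; exact H0.
Qed.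

(** Along the x-line the shift by [s] is a translation by [s 0], so the chain rule contributes the
    factor 1. *)
Lemma is_pdx_shift (F : times -> C) (s t : times) (l : C) :
  is_pdx F (t [+] s)%times l -> is_pdx (fun u => F (u [+] s)%times) t l.
Proof.
intros H.
apply is_derive_ext with (fun c => F (set_time (t [+] s)%times 0 (s 0%nat + (c - 0) * 1))).
{ intros c; rewrite set_time_tadd; do 2 f_equal; ring. }
refine (is_Cderive_eq _ _ _ _
  (is_Cderive_comp (fun c => F (set_time (t [+] s)%times 0 c)) _ _ l 1 _
    (is_Cderive_affine (s 0%nat) 0 1 _)) _); [| ring].
replace (s 0%nat + (t 0%nat - 0) * 1) with ((t [+] s)%times 0%nat); [exact H |].
unfold tadd; ring.
Qed.

(** Differentiability bounds the change of [F] by (|l| + 1) |c - t 0|, which is less than |F t|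
    within the chosen radius. Applied to tau, it keeps the quotients defined around [t]. *)
Lemma is_pdx_neq_0_near (F : times -> C) (t : times) (l : C) :
  is_pdx F t l -> F t <> 0 -> near_x t (fun u => F u <> 0).
Proof.
intros H H0.
destruct (proj1 (is_Cderive_eps _ _ _) H 1%R Rlt_0_1) as (d & Hd & Hw).
rewrite set_time_id in Hw.
assert (HF : (0 < Cmod (F t))%R) by now apply Cmod_gt_0.
assert (Hl := Cmod_ge_0 l).
exists (Rmin d (Cmod (F t) / (Cmod l + 1))); split.
{ apply Rmin_pos; [exact Hd | apply Rdiv_lt_0_compat; lra]. }
intros c Hc E.
specialize (Hw c (Rlt_le_trans _ _ _ Hc (Rmin_l _ _))).
assert (Hc' := Rlt_le_trans _ _ _ Hc (Rmin_r _ _)).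
rewrite E in Hw.
apply Rmult_lt_compat_r with (r := (Cmod l + 1)%R) in Hc'; [| lra].
replace (Cmod (F t) / (Cmod l + 1) * (Cmod l + 1))%R with (Cmod (F t)) in Hc' by (field; lra).
assert (T := Cmod_triangle (- (0 - F t - (c - t 0%nat) * l)) (- ((c - t 0%nat) * l))).
replace (- (0 - F t - (c - t 0%nat) * l) + - ((c - t 0%nat) * l)) with (F t) in T by ring.
rewrite !Cmod_opp, Cmod_mult in T.
lra.
Qed.

(** Only the term of index 0 contains x, so the tail and its convergence are unchanged and [xi] is
    affine in x with slope [z]. *)
Lemma xi_set_time (t : times) (z c : C) :
  ex_series (K := C_AbsRing) (V := C_NormedModule) (xi_term t z) ->
  ex_series (K := C_AbsRing) (V := C_NormedModule) (xi_term (set_time t 0 c) z) /\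
  xi (set_time t 0 c) z = xi t z + (c - t 0%nat) * z.
Proof.
intros H.
assert (H' : ex_series (K := C_AbsRing) (V := C_NormedModule) (xi_term (set_time t 0 c) z)).
{ apply ex_series_incr_1; apply ex_series_incr_1 in H; exact H. }
split; [exact H' |].
destruct (ex_series_Re_Im _ H) as [HR HI], (ex_series_Re_Im _ H') as [HR' HI'].
unfold xi, CSeries.
rewrite (Series_incr_1 _ HR), (Series_incr_1 _ HI), (Series_incr_1 _ HR'), (Series_incr_1 _ HI').
change (fun k : nat => Re (xi_term (set_time t 0 c) z (S k)))
  with (fun k : nat => Re (xi_term t z (S k))).
change (fun k : nat => Im (xi_term (set_time t 0 c) z (S k)))
  with (fun k : nat => Im (xi_term t z (S k))).
replace (xi_term (set_time t 0 c) z 0)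
  with (xi_term t z 0 + (c - t 0%nat) * z).
2:{ unfold xi_term; change (set_time t 0 c 0%nat) with c; simpl; ring. }
destruct (xi_term t z 0), ((c - t 0%nat) * z).
unfold Cplus; simpl; f_equal; ring.
Qed.

Lemma is_pdx_Cexp_xi (t : times) (z : C) :
  ex_series (K := C_AbsRing) (V := C_NormedModule) (xi_term t z) ->
  is_pdx (fun u => Cexp (xi u z)) t (z * Cexp (xi t z)) /\
  is_pdx (fun u => Cexp (- xi u z)) t (- z * Cexp (- xi t z)).
Proof.
intros H; split.
- apply is_derive_ext with (fun c => Cexp (xi t z + (c - t 0%nat) * z)).
  { intros c; now rewrite (proj2 (xi_set_time t z c H)). }
  apply is_Cderive_comp; [| apply is_Cderive_affine].
  replace (xi t z + (t 0%nat - t 0%nat) * z) with (xi t z) by ring.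
  apply is_Cderive_Cexp.
- apply is_derive_ext with (fun c => Cexp (- xi t z + (c - t 0%nat) * - z)).
  { intros c; rewrite (proj2 (xi_set_time t z c H)); f_equal; ring. }
  apply is_Cderive_comp; [| apply is_Cderive_affine].
  replace (- xi t z + (t 0%nat - t 0%nat) * - z) with (- xi t z) by ring.
  apply is_Cderive_Cexp.
Qed.

(** Serves to read off the first-order coefficient of an identity that holds on the whole disk,
    which may be all of C. *)
Lemma is_Cderive_vanishing_disk (f : C -> C) (rho : Rbar) (l : C) :
  Rbar_lt (Cmod 0) rho -> (forall w, Rbar_lt (Cmod w) rho -> f w = 0) ->
  is_Cderive f 0 l -> l = 0.
Proof.
intros H0 Hf Hl; apply (is_Cderive_unique _ _ _ _ Hl).
assert (Hloc : exists d : R, (0 < d)%R /\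
  forall w, (Cmod w < d)%R -> Rbar_lt (Cmod w) rho).
{ destruct rho as [r | |]; [exists r; split; auto | exists 1%R; split; [lra | easy] | easy].
  simpl in H0; now rewrite Cmod_0 in H0. }
destruct Hloc as (d & Hd & Hw).
apply is_derive_ext_loc with (fun _ => RtoC 0); [| apply is_Cderive_const].
exists (mkposreal d Hd); intros w Hwd; symmetry; apply Hf, Hw.
replace w with (w - 0) by ring; exact Hwd.
Qed.

(** * Algebra of the shifts *)

Lemma Copp_opp (z : C) : - - z = z.
Proof. ring. Qed.

Lemma Cinv_opp (z : C) : / - z = - / z.
Proof.
unfold Cinv, Copp; simpl; f_equal; unfold Rdiv;
  rewrite !Rmult_1_r, !Rmult_opp_opp; ring.
Qed.

Lemma bracket_0_shift (t : times) : (t [+] [[0]])%times = t.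
Proof.
apply functional_extensionality; intros n; unfold tadd, bracket.
rewrite Nat.add_1_r; simpl; unfold Cdiv; ring.
Qed.

Lemma tadd_comm_r (t s u : times) : (t [+] s [+] u)%times = (t [+] u [+] s)%times.
Proof. apply functional_extensionality; intros n; unfold tadd; ring. Qed.

Lemma tadd_topp_tadd (t s : times) : (t [-] s [+] s)%times = t.
Proof. apply functional_extensionality; intros n; unfold tadd, topp; ring. Qed.

(* Up to the evenness of tau this is t - [1/k], so that [psi tau z] has wave number z
   and [psi_star tau z] has wave number -z. *)
Definition miwa (k : C) (t : times) : times := (t [+] [[ - / k ]])%times.

Lemma miwa_comm (k l : C) (t : times) : miwa k (miwa l t) = miwa l (miwa k t).
Proof. apply tadd_comm_r. Qed.

(** * Evenness of tau and the differential Fay identity *)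

Section Tau.

Context (D : times -> Prop) (rho : Rbar) (tau : times -> C)
  (hD : tau_domain D rho) (hreg : regular D rho tau)
  (hFay : Fay_identity D rho tau) (hKdV : KdV_condition D tau).

Lemma near_x_domain (t : times) : D t -> near_x t D.
Proof. exact (domain_open hD t 0). Qed.

Lemma is_pdx_tau (t : times) : D t -> is_pdx tau t (pdx tau t).
Proof.
intros Ht; apply C_derive_correct; [exact (t 0%nat) |].
exact (regular_partial hreg t 0 Ht).
Qed.

Lemma Cmod_0_lt (z : C) : Rbar_lt (Cmod z) rho -> Rbar_lt (Cmod 0) rho.
Proof.
apply Rbar_le_lt_trans; simpl; rewrite Cmod_0; apply Cmod_ge_0.
Qed.

Lemma tau_shift_opp (t : times) (z : C) :
  D t -> Rbar_lt (Cmod z) rho -> tau (t [+] [[z]] [+] [[- z]])%times = tau t.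
Proof.
intros Ht Hz.
transitivity (tau (t [+] [[0]] [+] [[- 0]])%times).
2:{ replace (- 0) with (RtoC 0) by ring; now rewrite !bracket_0_shift. }
apply (Cderive_0_constant_disk (fun w => tau (t [+] [[w]] [+] [[- w]])%times) rho);
  [| exact Hz].
intros w Hw.
assert (Hw' : Rbar_lt (Cmod (- w)) rho) by now rewrite Cmod_opp.
assert (Hopp : is_Cderive (fun w => - w) w (- (1))).
{ apply is_derive_ext with (fun w => 0 + (w - 0) * - (1)).
  { intros v; change (0 + (v - 0) * - (1) = - v); ring. }
  apply is_Cderive_affine. }
destruct (regular_chain hreg t Ht Hw Hw' (is_Cderive_id w) Hopp) as [_ H].
refine (is_Cderive_eq _ _ _ _ H _).
assert (Hn : forall n, (1 * w ^ n + - (1) * (- w) ^ n)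
    * pd n tau (t [+] [[w]] [+] [[- w]])%times = 0).
{ intros n; destruct (Nat.Even_or_Odd n) as [ [k ->] | [k ->] ].
  - replace ((- w) ^ (2 * k)) with (w ^ (2 * k)); [ring |].
    rewrite !Cpow_mult_r; f_equal; simpl; ring.
  - rewrite (hKdV _ k); [ring |].
    now apply (domain_shift hD); [apply (domain_shift hD) |]. }
rewrite CSeries_head; intros; apply Hn.
Qed.

(** This is [tau_shift_opp] based at t - [z], where adding [z] returns to t. *)
Lemma tau_sub (t : times) (z : C) :
  D t -> Rbar_lt (Cmod z) rho -> tau (t [-] [[z]])%times = tau (t [+] [[- z]])%times.
Proof.
intros Ht Hz.
rewrite <- (tau_shift_opp (t [-] [[z]])%times z); [| now apply (domain_shift hD) | exact Hz].
now rewrite tadd_topp_tadd.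
Qed.

(** At w = 0 the powers w^n with n >= 1 vanish, which leaves the t_1-derivative. This is how
    x-derivatives come out of the Fay identity. *)
Lemma is_Cderive_tau_shift_0 (t : times) (z : C) :
  D t -> Rbar_lt (Cmod z) rho ->
  is_Cderive (fun w => tau (t [+] [[w]] [+] [[z]])%times) 0 (pdx tau (t [+] [[z]])%times).
Proof.
intros Ht Hz.
destruct (regular_chain hreg t (f := fun w => w) (g := fun _ => z) (z := RtoC 0)
  Ht (Cmod_0_lt z Hz) Hz (is_Cderive_id 0) (is_Cderive_const z 0)) as [_ H].
refine (is_Cderive_eq _ _ _ _ H _).
rewrite CSeries_head; rewrite bracket_0_shift.
- unfold pdx; simpl; ring.
- intros n; rewrite !Cpow_S; ring.
Qed.

(* The coefficient of z0 in the Fay identity at z3 = 0. *)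
Lemma differential_Fay (t : times) (a b : C) :
  D t -> Rbar_lt (Cmod a) rho -> Rbar_lt (Cmod b) rho ->
  a * b * (pdx tau (t [+] [[b]])%times * tau (t [+] [[a]])%times
           - pdx tau (t [+] [[a]])%times * tau (t [+] [[b]])%times)
  = (a - b) * (tau (t [+] [[a]])%times * tau (t [+] [[b]])%times
               - tau t * tau (t [+] [[a]] [+] [[b]])%times).
Proof.
intros Ht Ha Hb.
assert (H0 := Cmod_0_lt a Ha).
set (A := tau (t [+] [[a]])%times); set (B := tau (t [+] [[b]])%times).
set (G := tau (t [+] [[a]] [+] [[b]])%times).
assert (Hl : forall k c, is_Cderive (fun w => k + (w - 0) * c) 0 c)
  by (intros; apply is_Cderive_affine).
assert (Ht0 := is_Cderive_tau_shift_0 t 0 Ht H0).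
assert (HtA := is_Cderive_tau_shift_0 t a Ht Ha).
assert (HtB := is_Cderive_tau_shift_0 t b Ht Hb).
(* The three terms of the Fay identity at z0 = w, z1 = a, z2 = b, z3 = 0, each an affine function of
   w times a shifted tau. *)
assert (Hsum := is_Cderive_plus _ _ _ _ _ (is_Cderive_plus _ _ _ _ _
  (is_Cderive_mult _ _ _ _ _ (Hl (- (a * b * B)) (b * B)) HtA)
  (is_Cderive_mult _ _ _ _ _ (Hl (a * b * A) (- (a * A))) HtB))
  (is_Cderive_mult _ _ _ _ _ (Hl 0 ((a - b) * G)) Ht0)).
cbv beta in Hsum; rewrite !bracket_0_shift in Hsum.
fold A B in Hsum.
apply is_Cderive_vanishing_disk with (rho := rho) in Hsum; [| exact H0 |].
2:{ intros w Hw.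
  assert (F := hFay t w a b 0 Ht Hw Ha Hb H0).
  rewrite !bracket_0_shift in F.
  fold A B G in F; rewrite bracket_0_shift; refine (eq_trans _ F); ring. }
transitivity (a * b * (pdx tau (t [+] [[b]])%times * A
                       - pdx tau (t [+] [[a]])%times * B) - 0); [ring |].
rewrite <- Hsum; ring.
Qed.

(** * Fay identities in terms of wave numbers *)

Definition in_disk (k : C) : Prop := k <> 0 /\ Rbar_lt (Cmod (/ k)) rho.

Lemma in_disk_opp (k : C) : in_disk k -> in_disk (- k).
Proof.
intros [H0 Hk]; split.
- intros E; apply H0; rewrite <- (Copp_opp k), E; ring.
- now rewrite Cinv_opp, Cmod_opp.
Qed.

Lemma domain_miwa (k : C) (t : times) : in_disk k -> D t -> D (miwa k t).
Proof.
intros [_ Hk] Ht; apply (domain_shift hD); [exact Ht |]; now rewrite Cmod_opp.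
Qed.

Lemma tau_miwa_opp (k : C) (t : times) :
  in_disk k -> D t -> tau (miwa (- k) (miwa k t)) = tau t.
Proof.
intros [H0 Hk] Ht; rewrite <- (tau_shift_opp t (- / k) Ht); [| now rewrite Cmod_opp].
unfold miwa; now rewrite Cinv_opp.
Qed.

Lemma is_pdx_tau_miwa (k : C) (t : times) : in_disk k -> D t ->
  is_pdx (fun u => tau (miwa k u)) t (pdx tau (miwa k t)).
Proof. intros Hk Ht; now apply is_pdx_shift, is_pdx_tau, domain_miwa. Qed.

Lemma is_pdx_tau_miwa2 (k l : C) (t : times) : in_disk k -> in_disk l -> D t ->
  is_pdx (fun u => tau (miwa l (miwa k u))) t (pdx tau (miwa l (miwa k t))).
Proof.
intros Hk Hl Ht.
apply (is_pdx_shift (fun u => tau (miwa l u))), is_pdx_tau_miwa; [exact Hl |].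
now apply domain_miwa.
Qed.

(** [tau_miwa_opp] holds on a piece of the x-line around [t], so it can be differentiated. *)
Lemma pdx_tau_miwa_opp (k : C) (t : times) :
  in_disk k -> D t -> pdx tau (miwa (- k) (miwa k t)) = pdx tau t.
Proof.
intros Hk Ht; symmetry; apply is_pdx_unique.
apply is_pdx_ext_near with (fun u => tau (miwa (- k) (miwa k u))).
- apply near_x_impl with (2 := near_x_domain t Ht); intros u; now apply tau_miwa_opp.
- apply is_pdx_tau_miwa2; [exact Hk | now apply in_disk_opp | exact Ht].
Qed.

(** For a = -1/k and b = -1/l one has a b = 1/(k l) and a - b = (k - l)/(k l); the denominators
    cancel. *)
Lemma differential_Fay_miwa (k l : C) (t : times) :
  in_disk k -> in_disk l -> D t ->
  pdx tau (miwa l t) * tau (miwa k t) - pdx tau (miwa k t) * tau (miwa l t)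
  = (k - l) * (tau (miwa k t) * tau (miwa l t) - tau t * tau (miwa l (miwa k t))).
Proof.
intros [Hk0 Hk] [Hl0 Hl] Ht.
assert (F := differential_Fay t (- / k) (- / l) Ht).
rewrite !Cmod_opp in F; specialize (F Hk Hl); fold (miwa k t) (miwa l t) in F.
fold (miwa l (miwa k t)) in F.
apply (f_equal (fun c => k * l * c)) in F.
transitivity (k * l * (- / k * - / l * (pdx tau (miwa l t) * tau (miwa k t)
  - pdx tau (miwa k t) * tau (miwa l t)))); [field; auto |].
rewrite F; field; auto.
Qed.

(* The differential Fay identity based at [miwa k t], for the shifts by -k and l. *)
Lemma differential_Fay_from_origin (k l : C) (t : times) :
  in_disk k -> in_disk l -> D t ->
  pdx tau (miwa l (miwa k t)) * tau t - pdx tau t * tau (miwa l (miwa k t))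
  = (k + l) * (tau (miwa k t) * tau (miwa l t) - tau t * tau (miwa l (miwa k t))).
Proof.
intros Hk Hl Ht.
assert (F := differential_Fay_miwa (- k) l (miwa k t) (in_disk_opp k Hk) Hl
  (domain_miwa k t Hk Ht)).
rewrite (miwa_comm l (- k)), (miwa_comm l k t) in F.
rewrite (pdx_tau_miwa_opp k t), !tau_miwa_opp in F;
  try assumption; try now apply domain_miwa.
rewrite (miwa_comm l k t), F; ring.
Qed.

(** The Fay identity at -1/k, -1/l, 1/k, 1/l, multiplied by k^2 l^2. Opposite shifts cancel by
    evenness, whence the term in [tau t ^ 2]. *)
Lemma Fay_miwa (k l : C) (t : times) : in_disk k -> in_disk l -> D t ->
  (k + l) ^ 2 * (tau (miwa (- l) (miwa k t)) * tau (miwa l (miwa (- k) t)))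
  = (k - l) ^ 2 * (tau (miwa l (miwa k t)) * tau (miwa (- l) (miwa (- k) t)))
    + 4 * k * l * tau t ^ 2.
Proof.
intros Hk Hl Ht.
assert (F := hFay t (- / k) (- / l) (- / - k) (- / - l) Ht).
rewrite !Cmod_opp in F.
specialize (F (proj2 Hk) (proj2 Hl) (proj2 (in_disk_opp k Hk)) (proj2 (in_disk_opp l Hl))).
fold (miwa k t) (miwa l t) (miwa (- k) t) (miwa (- l) t) in F.
fold (miwa l (miwa k t)) (miwa (- k) (miwa k t)) (miwa (- l) (miwa k t)) in F.
fold (miwa (- l) (miwa (- k) t)) (miwa l (miwa (- l) t)) (miwa (- k) (miwa l t)) in F.
rewrite (miwa_comm l (- l)), !tau_miwa_opp, (miwa_comm (- k) l) in F by assumption.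
rewrite !Cinv_opp in F.
destruct Hk as [Hk0 _], Hl as [Hl0 _].
apply (f_equal (fun c => k ^ 2 * l ^ 2 * c)) in F.
(* Adding [L - R], which is zero by [F], turns the goal into an identity of rational functions. *)
match type of F with ?L = ?R =>
  transitivity ((k - l) ^ 2 * (tau (miwa l (miwa k t)) * tau (miwa (- l) (miwa (- k) t)))
    + 4 * k * l * tau t ^ 2 + (L - R)) end; [field; auto | rewrite F; ring].
Qed.

(** * Wave functions and their Wronskians *)

Lemma psi_miwa (z : C) (t : times) : in_disk z -> D t ->
  psi tau z t = Cexp (xi t z) * (tau (miwa z t) / tau t).
Proof. intros [_ Hz] Ht; unfold psi; now rewrite tau_sub. Qed.

Lemma psi_star_miwa (z : C) (t : times) :
  psi_star tau z t = Cexp (- xi t z) * (tau (miwa (- z) t) / tau t).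
Proof. unfold psi_star, miwa; now rewrite Cinv_opp, Copp_opp. Qed.

(** Leaving the exponential [e] of rate [k] abstract covers both [psi] (k = z) and [psi_star] (k =
    -z). *)
Lemma is_pdx_wave (P e : times -> C) (k : C) (t : times) :
  in_disk k -> D t -> tau t <> 0 ->
  (forall u, D u -> P u = e u * (tau (miwa k u) / tau u)) ->
  is_pdx e t (k * e t) ->
  is_pdx P t (e t * (k * tau (miwa k t) * tau t + pdx tau (miwa k t) * tau t
                     - tau (miwa k t) * pdx tau t) / tau t ^ 2).
Proof.
intros Hk Ht H0 HP He.
apply is_pdx_ext_near with (fun u => e u * (tau (miwa k u) * / tau u)).
- apply near_x_impl with (2 := near_x_domain t Ht).
  intros u Hu; now rewrite HP.
- refine (is_pdx_eq _ _ _ _ (is_pdx_mult _ _ _ _ _ He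
    (is_pdx_mult _ _ _ _ _ (is_pdx_tau_miwa k t Hk Ht)
      (is_pdx_inv _ _ _ H0 (is_pdx_tau t Ht)))) _).
  field; exact H0.
Qed.

(** The terms in [pdx tau t] cancel by antisymmetry. What remains of the derivatives is the left
    side of [differential_Fay_miwa], whose product of single shifts cancels the contribution of the
    exponentials. *)
Lemma wronskian_waves (P Q e1 e2 : times -> C) (k l : C) (t : times) :
  in_disk k -> in_disk l -> D t -> tau t <> 0 ->
  (forall u, D u -> P u = e1 u * (tau (miwa k u) / tau u)) ->
  (forall u, D u -> Q u = e2 u * (tau (miwa l u) / tau u)) ->
  is_pdx e1 t (k * e1 t) -> is_pdx e2 t (l * e2 t) ->
  wronskian P Q t = e1 t * e2 t * (l - k) * (tau (miwa l (miwa k t)) / tau t).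
Proof.
intros Hk Hl Ht H0 HP HQ He1 He2; unfold wronskian.
rewrite (is_pdx_unique _ _ _ (is_pdx_wave P e1 k t Hk Ht H0 HP He1)).
rewrite (is_pdx_unique _ _ _ (is_pdx_wave Q e2 l t Hl Ht H0 HQ He2)).
rewrite HP, HQ by exact Ht.
assert (F := differential_Fay_miwa k l t Hk Hl Ht).
transitivity (e1 t * e2 t / tau t ^ 2 *
  ((l - k) * (tau (miwa k t) * tau (miwa l t)) +
   (pdx tau (miwa l t) * tau (miwa k t) - pdx tau (miwa k t) * tau (miwa l t)))).
{ field; exact H0. }
rewrite F; field; exact H0.
Qed.

(** Both products of Wronskians are affine in this ratio with constant coefficients. The inverse
    square is a product so that [is_pdx_mult] and [is_pdx_inv] apply. *)
Definition tau_ratio (k l : C) (t : times) : C :=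
  tau (miwa l (miwa k t)) * tau (miwa (- l) (miwa (- k) t)) * (/ tau t * / tau t).

(** With G and H the doubly shifted taus, [differential_Fay_from_origin] gives the derivatives of
    G/tau and H/tau. Their factors k + l and -(k + l) are opposite, so the terms in G H cancel. *)
Lemma is_pdx_tau_ratio (k l : C) (t : times) :
  in_disk k -> in_disk l -> D t -> tau t <> 0 ->
  is_pdx (tau_ratio k l) t
    ((k + l) * (tau (miwa k t) * tau (miwa l t) * tau (miwa (- l) (miwa (- k) t))
       - tau (miwa (- k) t) * tau (miwa (- l) t) * tau (miwa l (miwa k t))) / tau t ^ 3).
Proof.
intros Hk Hl Ht H0.
assert (Hk' := in_disk_opp k Hk); assert (Hl' := in_disk_opp l Hl).
assert (Hi := is_pdx_inv _ _ _ H0 (is_pdx_tau t Ht)).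
refine (is_pdx_eq _ _ _ _ (is_pdx_mult _ _ _ _ _
  (is_pdx_mult _ _ _ _ _ (is_pdx_tau_miwa2 k l t Hk Hl Ht)
    (is_pdx_tau_miwa2 (- k) (- l) t Hk' Hl' Ht))
  (is_pdx_mult _ _ _ _ _ Hi Hi)) _).
assert (F := differential_Fay_from_origin k l t Hk Hl Ht).
assert (F' := differential_Fay_from_origin (- k) (- l) t Hk' Hl' Ht).
set (G := tau (miwa l (miwa k t))) in *.
set (H := tau (miwa (- l) (miwa (- k) t))) in *.
transitivity ((H * (pdx tau (miwa l (miwa k t)) * tau t - pdx tau t * G)
  + G * (pdx tau (miwa (- l) (miwa (- k) t)) * tau t - pdx tau t * H)) / tau t ^ 3).
{ field; exact H0. }
rewrite F, F'; field; exact H0.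
Qed.

(** The derivatives group into [differential_Fay_miwa] for (k, l) and for (-k, -l), and the products
    of four single shifts cancel. The bracket is that of [is_pdx_tau_ratio], with k - l in place of
    k + l. *)
Lemma wronskian_squared_waves (P Q : times -> C) (k l : C) (t : times) :
  in_disk k -> in_disk l -> D t -> tau t <> 0 ->
  (forall u, D u -> P u = tau (miwa k u) * tau (miwa (- k) u) * (/ tau u * / tau u)) ->
  (forall u, D u -> Q u = tau (miwa l u) * tau (miwa (- l) u) * (/ tau u * / tau u)) ->
  wronskian P Q t =
    (k - l) * (tau (miwa k t) * tau (miwa l t) * tau (miwa (- l) (miwa (- k) t))
       - tau (miwa (- k) t) * tau (miwa (- l) t) * tau (miwa l (miwa k t))) / tau t ^ 3.
Proof.
intros Hk Hl Ht H0 HP HQ.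
assert (Hk' := in_disk_opp k Hk); assert (Hl' := in_disk_opp l Hl).
assert (Hi := is_pdx_inv _ _ _ H0 (is_pdx_tau t Ht)).
assert (Hd : forall (R : times -> C) m, in_disk m ->
  (forall u, D u -> R u = tau (miwa m u) * tau (miwa (- m) u) * (/ tau u * / tau u)) ->
  pdx R t = (pdx tau (miwa m t) * tau (miwa (- m) t)
             + tau (miwa m t) * pdx tau (miwa (- m) t)) / tau t ^ 2
            - 2 * tau (miwa m t) * tau (miwa (- m) t) * pdx tau t / tau t ^ 3).
{ intros R m Hm HR; apply is_pdx_unique.
  apply is_pdx_ext_near
    with (fun u => tau (miwa m u) * tau (miwa (- m) u) * (/ tau u * / tau u)).
  { apply near_x_impl with (2 := near_x_domain t Ht).
    intros u Hu; now rewrite HR. }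
  refine (is_pdx_eq _ _ _ _ (is_pdx_mult _ _ _ _ _
    (is_pdx_mult _ _ _ _ _ (is_pdx_tau_miwa m t Hm Ht)
      (is_pdx_tau_miwa (- m) t (in_disk_opp m Hm) Ht))
    (is_pdx_mult _ _ _ _ _ Hi Hi)) _).
  field; exact H0. }
unfold wronskian; rewrite (Hd P k Hk HP), (Hd Q l Hl HQ), HP, HQ by exact Ht.
assert (F := differential_Fay_miwa k l t Hk Hl Ht).
assert (F' := differential_Fay_miwa (- k) (- l) t Hk' Hl' Ht).
transitivity ((tau (miwa (- k) t) * tau (miwa (- l) t) *
   (pdx tau (miwa l t) * tau (miwa k t) - pdx tau (miwa k t) * tau (miwa l t))
  + tau (miwa k t) * tau (miwa l t) *
   (pdx tau (miwa (- l) t) * tau (miwa (- k) t)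
    - pdx tau (miwa (- k) t) * tau (miwa (- l) t))) / tau t ^ 4).
{ field; exact H0. }
rewrite F, F'; field; exact H0.
Qed.

(** The exponentials cancel in pairs. In the second product [Fay_miwa] trades the mixed shifts for
    those of [tau_ratio], at the cost of a constant. *)
Lemma wronskian_products (z1 z2 : C) (t : times) :
  in_disk z1 -> in_disk z2 -> D t -> tau t <> 0 ->
  ex_series (K := C_AbsRing) (V := C_NormedModule) (xi_term t z1) ->
  ex_series (K := C_AbsRing) (V := C_NormedModule) (xi_term t z2) ->
  wronskian (psi tau z1) (psi tau z2) t * wronskian (psi_star tau z1) (psi_star tau z2) t
    = - (z1 - z2) ^ 2 * tau_ratio z1 z2 t /\
  wronskian (psi tau z1) (psi_star tau z2) t * wronskian (psi_star tau z1) (psi tau z2) t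
    = - (z1 - z2) ^ 2 * tau_ratio z1 z2 t - 4 * z1 * z2.
Proof.
intros Hz1 Hz2 Ht H0 Hx1 Hx2.
assert (Hz1' := in_disk_opp z1 Hz1); assert (Hz2' := in_disk_opp z2 Hz2).
destruct (is_pdx_Cexp_xi t z1 Hx1) as [He1 He1'].
destruct (is_pdx_Cexp_xi t z2 Hx2) as [He2 He2'].
assert (Hp1 := fun u => psi_miwa z1 u Hz1); assert (Hp2 := fun u => psi_miwa z2 u Hz2).
assert (Hs1 := fun u (_ : D u) => psi_star_miwa z1 u).
assert (Hs2 := fun u (_ : D u) => psi_star_miwa z2 u).
assert (E1 := Cexp_mul_opp (xi t z1)); assert (E2 := Cexp_mul_opp (xi t z2)).
rewrite (wronskian_waves _ _ _ _ z1 z2 t Hz1 Hz2 Ht H0 Hp1 Hp2 He1 He2).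
rewrite (wronskian_waves _ _ _ _ _ _ t Hz1' Hz2' Ht H0 Hs1 Hs2 He1' He2').
rewrite (wronskian_waves _ _ _ _ _ _ t Hz1 Hz2' Ht H0 Hp1 Hs2 He1 He2').
rewrite (wronskian_waves _ _ _ _ _ _ t Hz1' Hz2 Ht H0 Hs1 Hp2 He1' He2).
assert (F := Fay_miwa z1 z2 t Hz1 Hz2 Ht).
unfold tau_ratio.
set (e1 := Cexp (xi t z1)) in *; set (e1' := Cexp (- xi t z1)) in *.
set (e2 := Cexp (xi t z2)) in *; set (e2' := Cexp (- xi t z2)) in *.
set (G := tau (miwa z2 (miwa z1 t))) in *.
set (H := tau (miwa (- z2) (miwa (- z1) t))) in *.
set (M := tau (miwa (- z2) (miwa z1 t))) in *.
set (N := tau (miwa z2 (miwa (- z1) t))) in *.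
split.
- transitivity ((e1 * e1') * (e2 * e2') * (- (z1 - z2) ^ 2 * (G * H * (/ tau t * / tau t)))).
  { field; exact H0. }
  rewrite E1, E2; ring.
- transitivity ((e1 * e1') * (e2 * e2') * - ((z1 + z2) ^ 2 * (M * N)) / tau t ^ 2).
  { field; exact H0. }
  rewrite E1, E2, F; field; exact H0.
Qed.

End Tau.

Theorem theorem1p1 (D : times -> Prop) (rho : Rbar) (tau : times -> C)
  (hD : tau_domain D rho)
  (hreg : regular D rho tau)
  (hnz : not_identically_zero D tau)
  (hFay : Fay_identity D rho tau)
  (hKdV : KdV_condition D tau)
  (t : times) (z1 z2 : C)
  (ht : D t) (htau : tau t <> 0)
  (hz1 : z1 <> 0) (hz2 : z2 <> 0) (hz : z1 ^ 2 <> z2 ^ 2)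
  (hrho1 : Rbar_lt (Cmod (/ z1)) rho) (hrho2 : Rbar_lt (Cmod (/ z2)) rho)
  (hxi1 : ex_series (K := C_AbsRing) (V := C_NormedModule) (xi_term t z1))
  (hxi2 : ex_series (K := C_AbsRing) (V := C_NormedModule) (xi_term t z2)) :
  wronskian (fun s => psi tau z1 s * psi_star tau z1 s)
            (fun s => psi tau z2 s * psi_star tau z2 s) t
  = - / (z1 ^ 2 - z2 ^ 2)
    * pdx (fun s => wronskian (psi tau z1) (psi tau z2) s
                    * wronskian (psi_star tau z1) (psi_star tau z2) s) t
  /\
  - / (z1 ^ 2 - z2 ^ 2)
    * pdx (fun s => wronskian (psi tau z1) (psi tau z2) s
                    * wronskian (psi_star tau z1) (psi_star tau z2) s) t
  = - / (z1 ^ 2 - z2 ^ 2)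
    * pdx (fun s => wronskian (psi tau z1) (psi_star tau z2) s
                    * wronskian (psi_star tau z1) (psi tau z2) s) t.
Proof.
assert (Hz1 : in_disk rho z1) by now split.
assert (Hz2 : in_disk rho z2) by now split.
assert (Hr := is_pdx_tau_ratio D rho tau hD hreg hFay hKdV z1 z2 t Hz1 Hz2 ht htau).
assert (Hprod := is_pdx_mult _ _ _ _ _ (is_pdx_const (- (z1 - z2) ^ 2) t) Hr).
(* The formulas are needed around [t] on the x-line in order to be differentiated: there the points
   stay in [D], tau stays nonzero and the series [xi] still converge. *)
assert (Hnear : near_x t (fun u =>
  wronskian (psi tau z1) (psi tau z2) u * wronskian (psi_star tau z1) (psi_star tau z2) u
    = - (z1 - z2) ^ 2 * tau_ratio tau z1 z2 u /\
  wronskian (psi tau z1) (psi_star tau z2) u * wronskian (psi_star tau z1) (psi tau z2) u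
    = - (z1 - z2) ^ 2 * tau_ratio tau z1 z2 u + - (4 * z1 * z2))).
{ destruct (near_x_and _ _ _ (near_x_domain D rho hD t ht)
    (is_pdx_neq_0_near _ _ _ (is_pdx_tau D rho tau hreg t ht) htau)) as (d & Hd & H).
  exists d; split; [exact Hd |]; intros c Hc; destruct (H c Hc) as [HDc H0c].
  exact (wronskian_products D rho tau hD hreg hFay hKdV z1 z2 _ Hz1 Hz2 HDc H0c
    (proj1 (xi_set_time t z1 c hxi1)) (proj1 (xi_set_time t z2 c hxi2))). }
erewrite (is_pdx_unique (fun s => wronskian (psi tau z1) (psi tau z2) s * _ s)).
2:{ eapply is_pdx_ext_near; [| exact Hprod].
    apply near_x_impl with (2 := Hnear); intros u [E _]; now rewrite E. }
erewrite (is_pdx_unique (fun s => wronskian (psi tau z1) (psi_star tau z2) s * _ s)).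
2:{ eapply is_pdx_ext_near;
      [| exact (is_pdx_plus _ _ _ _ _ Hprod (is_pdx_const (- (4 * z1 * z2)) t))].
    apply near_x_impl with (2 := Hnear); intros u [_ E]; now rewrite E. }
(* The two derivatives now differ only by the 0 that comes from the constant 4 z1 z2. *)
split; [| ring].
assert (Hsq : forall z, in_disk rho z -> forall u, D u ->
  psi tau z u * psi_star tau z u
  = tau (miwa z u) * tau (miwa (- z) u) * (/ tau u * / tau u)).
{ intros z Hz u Hu; rewrite (psi_miwa D rho tau hD hreg hKdV), psi_star_miwa by assumption.
  transitivity (Cexp (xi u z) * Cexp (- xi u z)
    * (tau (miwa z u) * tau (miwa (- z) u) * (/ tau u * / tau u))).
  - unfold Cdiv; ring.
  - rewrite Cexp_mul_opp; ring. }
rewrite (wronskian_squared_waves D rho tau hD hreg hFay _ _ z1 z2 t Hz1 Hz2 ht htau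
  (Hsq z1 Hz1) (Hsq z2 Hz2)).
(* Here (z1 - z2)^2 (z1 + z2) / (z1^2 - z2^2) reduces to z1 - z2, the factor of the left side. *)
field; repeat split; [exact htau |].
intros E; apply hz; rewrite <- (Cplus_0_r (z2 ^ 2)), <- E; ring.
Qed.
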